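(* Let $n\ge1$ and $\varphi(\rho)=\mathcal{X}_{(0,1)}(\rho)$. For $j\in\mathbb{Z}^+$ let $\Pi_j$ be the joint distribution of a positive random variable $\varepsilon_j$ and an $\mathbb{R}^n$-valued random vector $y_j$. Assume that $\Pi_j(E)=\Pi_1(jE)$ for every $j\in\mathbb{Z}^+$ and every Borel set $E\subseteq\mathbb{R}^{n+1}$, that $\operatorname{supp}\Pi_1\subset[0,\alpha]\times\overline{B}(0,\beta)$ for some $\alpha,\beta>0$, and that $d\Pi_1(s,y)=\gamma(s,y)\,ds\,dy$ with $\gamma\in L^1(\mathbb{R}^+,L^\infty(\mathbb{R}^n))$. Then $\mathscr{M}f$ is dominated by the Hardy-Littlewood maximal function $f^*$, i.e. there is a constant $C>0$, independent of $f$ and $x$, such that $\mathscr{M}f(x)\le C f^*(x)$ for every measurable $f$ on $\mathbb{R}^n$ and every $x\in\mathbb{R}^n$.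
   Context: $\mathbb{R}^+=\{t\in\mathbb{R}:t>0\}$, $\mathbb{Z}^+=\{1,2,3,\dots\}$; $\mathcal{X}_S$ is the indicator function of $S$; $jE=\{jp:p\in E\}$; $\overline{B}(0,\beta)$ is the closed Euclidean ball in $\mathbb{R}^n$. The random variables $\varepsilon_j$ and vectors $y_j$ are defined on a probability space $(\Omega,\mathscr{F},\mathscr{P})$ with expectation $\mathscr{E}$, and $\Pi_j(E)=\mathscr{P}(\{\omega:(\varepsilon_j(\omega),y_j(\omega))\in E\})$. The condition $\gamma\in L^1(\mathbb{R}^+,L^\infty(\mathbb{R}^n))$ means $\int_{\mathbb{R}^+}\|\gamma(s,\cdot)\|_{L^\infty(\mathbb{R}^n)}\,ds<\infty$. The maximal operator is $$\mathscr{M}f(x)=\sup_{j\geq 1}\mathscr{E}\left[\int_{z\in\mathbb{R}^n}\frac{1}{\varepsilon_j^n(\omega)}\varphi\left(\frac{|x-y_j(\omega)-z|}{\varepsilon_j(\omega)}\right)|f(z)|\,dz\right].$$ The Hardy-Littlewood maximal function on centered balls is $f^*(x)=\sup_{r>0}\frac{1}{|B(x,r)|}\int_{B(x,r)}|f(z)|\,dz$. *)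

(* Defs.v *)
From HB Require Import structures.
From mathcomp Require Import all_boot all_order all_algebra.
From mathcomp Require Import all_classical all_reals all_analysis.
From mathcomp Require Import measurable_realfun.

Set Implicit Arguments.
Unset Strict Implicit.
Unset Printing Implicit Defensive.

Import Order.TTheory GRing.Theory Num.Theory.
Import numFieldNormedType.Exports.

Local Open Scope classical_set_scope.
Local Open Scope ring_scope.

(* R^n is 'rV[R]_n, with the sigma-algebra generated by the coordinates (as
   for n.-tuple R); by second countability these are the Borel sets.          *)
Section measurable_rV.
Context (R : realType) (n : nat).

Let coord (i : 'I_n) (v : 'rV[R]_n) : R := v ord0 i.

Let rV_set0 : g_sigma_preimage coord set0.
Proof. exact: sigma_algebra0. Qed.

Let rV_setC A : g_sigma_preimage coord A -> g_sigma_preimage coord (~` A).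
Proof. exact: sigma_algebraC. Qed.

Let rV_bigcup (F : (set 'rV[R]_n)^nat) :
  (forall i, g_sigma_preimage coord (F i)) ->
  g_sigma_preimage coord (\bigcup_i F i).
Proof. exact: sigma_algebra_bigcup. Qed.

HB.instance Definition _ := @isMeasurable.Build default_measure_display
  'rV[R]_n (g_sigma_preimage coord) rV_set0 rV_setC rV_bigcup.

Lemma measurable_rV_coord (i : 'I_n) :
  measurable_fun [set: 'rV[R]_n] (fun v => v ord0 i).
Proof.
move=> _ Y mY; rewrite setTI; apply: sub_sigma_algebra => /=.
rewrite -bigcup_seq/=; exists i => /=; first by rewrite mem_index_enum.
by exists Y => //; rewrite setTI.
Qed.

Lemma measurable_fun_rVP d (T : measurableType d) (f : T -> 'rV[R]_n) :
  (forall i, measurable_fun [set: T] (fun x => f x ord0 i)) ->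
  measurable_fun [set: T] f.
Proof.
move=> mf.
suff H : g_sigma_preimage coord `<=` image_set_system setT f measurable.
  by move=> _ A /H; rewrite /image_set_system /=.
apply: smallest_sub.
  by apply: sigma_algebra_image; exact: sigma_algebra_measurable.
move=> A; rewrite -bigcup_seq/= => -[i _ [Y mY <-]].
by rewrite /image_set_system /= setTI; exact: mf.
Qed.

End measurable_rV.

Section lebesgue_rV.
Context (R : realType).
Local Open Scope ereal_scope.

Definition rV_cons n (p : R * 'rV[R]_n) : 'rV[R]_n.+1 :=
  row_mx (p.1%:M : 'rV_1) p.2.

Let rV_uncons n (v : 'rV[R]_n.+1) : R * 'rV[R]_n :=
  (v ord0 ord0, \row_i v ord0 (lift ord0 i)).

Let rV_consK n : cancel (@rV_cons n) (@rV_uncons n).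
Proof.
move=> [x v]; rewrite /rV_cons /rV_uncons /=; congr pair.
  rewrite (_ : (ord0 : 'I_n.+1) = lshift n (ord0 : 'I_1)); last exact/val_inj.
  by rewrite (row_mxEl (x%:M : 'rV_1) v) mxE eqxx.
apply/rowP => i; rewrite mxE.
rewrite (_ : lift ord0 i = rshift 1 i) ; last exact/val_inj.
by rewrite (row_mxEr (x%:M : 'rV_1) v).
Qed.

Lemma measurable_rV_cons n : measurable_fun [set: R * 'rV[R]_n] (@rV_cons n).
Proof.
apply: measurable_fun_rVP => i.
have [j ->|j ->] := @split_ordP 1 n i.
  rewrite (_ : (fun _ => _) = fst) //.
  apply/funext => -[x v].
  by rewrite /rV_cons (row_mxEl (x%:M : 'rV_1) v) mxE !ord1 eqxx.
rewrite (_ : (fun _ => _) = (fun v : 'rV[R]_n => v ord0 j) \o snd).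
  by apply: measurableT_comp => //; exact: measurable_rV_coord.
by apply/funext => -[x v]; rewrite /rV_cons (row_mxEr (x%:M : 'rV_1) v).
Qed.

Let measurable_rV_uncons n : measurable_fun [set: 'rV[R]_n.+1] (@rV_uncons n).
Proof.
apply: measurable_fun_pair; first exact: measurable_rV_coord.
apply: measurable_fun_rVP => i.
under eq_fun do rewrite mxE.
exact: measurable_rV_coord.
Qed.

Section step.
Context (n : nat) (m : {sigma_finite_measure set 'rV[R]_n -> \bar R}).

Definition lebesgue_rV_step : set 'rV[R]_n.+1 -> \bar R :=
  pushforward (lebesgue_measure \x m) (@rV_cons n).

Let lebesgue_rV_step0 : lebesgue_rV_step set0 = 0.
Proof. by apply: measure0; exact: measurable_rV_cons. Qed.

Let lebesgue_rV_step_ge0 A : 0 <= lebesgue_rV_step A.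
Proof. by apply: measure_ge0; exact: measurable_rV_cons. Qed.

Let lebesgue_rV_step_sigma_additive : semi_sigma_additive lebesgue_rV_step.
Proof.
by apply: measure_semi_sigma_additive; exact: measurable_rV_cons.
Qed.

HB.instance Definition _ := isMeasure.Build _ _ _ lebesgue_rV_step
  lebesgue_rV_step0 lebesgue_rV_step_ge0 lebesgue_rV_step_sigma_additive.

Let lebesgue_rV_step_sigma_finite : sigma_finite setT lebesgue_rV_step.
Proof.
have /sigma_finiteP[F [FT ndF Foo]] := sigma_finiteT (@lebesgue_measure R).
have /sigma_finiteP[G [GT ndG Goo]] := sigma_finiteT m.
exists (fun k => @rV_uncons n @^-1` (F k `*` G k)).
  rewrite -preimage_bigcup (_ : \bigcup_k _ = setT) ?preimage_setT//.
  apply/seteqP; split => // -[x v] _.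
  have [i _ Fix] : (\bigcup_k F k) x by rewrite -FT.
  have [k _ Gkv] : (\bigcup_k G k) v by rewrite -GT.
  exists (maxn i k) => //; split => /=.
    by move: x Fix; exact/subsetPset/ndF/leq_maxl.
  by move: v Gkv; exact/subsetPset/ndG/leq_maxr.
move=> k; have [mF Fk] := Foo k; have [mG Gk] := Goo k; split.
  rewrite -[X in measurable X]setTI; apply: measurable_rV_uncons => //.
  exact: measurableX.
rewrite /lebesgue_rV_step /pushforward -comp_preimage.
rewrite (_ : _ \o _ = id); last by apply/funext => p /=; rewrite rV_consK.
by rewrite preimage_id product_measure1E// lte_mul_pinfty// ge0_fin_numE.
Qed.

HB.instance Definition _ := Measure_isSigmaFinite.Build _ _ _
  lebesgue_rV_step lebesgue_rV_step_sigma_finite.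

End step.

(* Lebesgue measure on R^n as the n-fold product of Lebesgue measure on R. *)
Fixpoint lebesgue_rV n : {sigma_finite_measure set 'rV[R]_n -> \bar R} :=
  match n with
  | 0%N => dirac (0%R : 'rV[R]_0)
  | k.+1 => lebesgue_rV_step (lebesgue_rV k)
  end.

End lebesgue_rV.
Arguments lebesgue_rV {R} n.

(* f is measurable on D for the completion of mu; for mu a Lebesgue measure on
   the Borel sets this is Lebesgue measurability. The library integral of a
   nonnegative function is a supremum over simple minorants, so for such an f
   it agrees with the integral against the completed measure.                 *)
Definition completed_measurable_fun d (T : measurableType d) (R : realType)
    (mu : set T -> \bar R) (D : set T) (f : T -> R) : Prop :=
  forall Y : set R, measurable Y -> completed_algebra_gen mu (D `&` f @^-1` Y).

(* The library norm on 'rV[R]_n is the sup norm. *)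
Definition enorm (R : realType) n (v : 'rV[R]_n) : R :=
  Num.sqrt (\sum_i v ord0 i ^+ 2).

Definition eball (R : realType) n (x : 'rV[R]_n) (r : R) : set 'rV[R]_n :=
  [set z | enorm (x - z) < r].

Definition eclosed_ball (R : realType) n (x : 'rV[R]_n) (r : R) :
    set 'rV[R]_n :=
  [set z | enorm (x - z) <= r].

Definition support_of (T : topologicalType) (R : realType)
    (mu : set T -> \bar R) : set T :=
  [set p | forall U : set T, open U -> U p -> (0 < mu U)%E].

Definition scale_set (R : realType) n (j : nat) (E : set (R * 'rV[R]_n)) :
    set (R * 'rV[R]_n) :=
  [set (j%:R * p.1, j%:R *: p.2) | p in E].

Definition joint_law d (Omega : measurableType d) (R : realType) n
    (P : probability Omega R) (e : Omega -> R) (v : Omega -> 'rV[R]_n) :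
    set (R * 'rV[R]_n) -> \bar R :=
  pushforward P (fun w => (e w, v w)).

(* dPi(s, y) = gamma(s, y) ds dy; only the values gamma(s, y), s > 0, matter. *)
Definition has_density (R : realType) n (Pi : set (R * 'rV[R]_n) -> \bar R)
    (gamma : R * 'rV[R]_n -> R) : Prop :=
  let D := (`]0, +oo[ : set R) `*` [set: 'rV[R]_n] in
  let mu := (lebesgue_measure \x lebesgue_rV n)%E in
  [/\ completed_measurable_fun mu D gamma,
      (forall p, D p -> 0 <= gamma p) &
      forall E, measurable E ->
        Pi E = (\int[mu]_(p in D `&` E) (gamma p)%:E)%E].

Definition L1Linfty (R : realType) n (gamma : R * 'rV[R]_n -> R) : Prop :=
  (\int[lebesgue_measure]_(s in `]0%R, +oo[)
     Lnorm (lebesgue_rV n) +oo (fun y => (gamma (s, y))%:E) < +oo)%E.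

Definition maximal_op d (Omega : measurableType d) (R : realType) n
    (P : probability Omega R) (eps : nat -> Omega -> R)
    (y : nat -> Omega -> 'rV[R]_n) (phi : R -> R) (f : 'rV[R]_n -> R)
    (x : 'rV[R]_n) : \bar R :=
  ereal_sup [set (\int[P]_w \int[lebesgue_rV n]_z
      ((eps j w ^+ n)^-1 * phi (enorm (x - y j w - z) / eps j w)
         * `|f z|)%:E)%E | j in [set j | (1 <= j)%N]].

Definition HL_maximal_rV (R : realType) n (f : 'rV[R]_n -> R)
    (x : 'rV[R]_n) : \bar R :=
  ereal_sup [set ((lebesgue_rV n (eball x r))^-1 *
      \int[lebesgue_rV n]_(z in eball x r) `|f z|%:E)%E | r in `]0, +oo[].

(* Main.v *)
Require Import Defs.
From HB Require Import structures.
From mathcomp Require Import all_boot all_order all_algebra.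
From mathcomp Require Import all_classical all_reals all_analysis.
From mathcomp Require Import measurable_realfun ess_sup_inf hoelder.
From mathcomp Require Import ring.

Set Implicit Arguments.
Unset Strict Implicit.
Unset Printing Implicit Defensive.

Import Order.TTheory GRing.Theory Num.Theory.
Import numFieldNormedType.Exports.

Local Open Scope classical_set_scope.
Local Open Scope ring_scope.

(** The pairs (eps_j, y_j) have the law of (eps_1, y_1) / j. For p = (s, y) put
    K(p, u) = s^-n when |u - y| < s and 0 otherwise ([ball_kernel]); the j-th
    average in the maximal operator is the expectation of the integral of
    K((eps_j, y_j), x - z) |f z| over z. By Tonelli it equals the integral of
    K_j(x - z) |f z|, where K_j(u) is the mean of K(., u) under the j-th law,
    and the scaling of the laws gives K_j(u) = j^n K_1(j u)
    ([integral_ball_kernel_scale]). So the whole family is the approximate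
    identity generated by K_1, and the theorem follows once K_1 is bounded with
    bounded support.

    Boundedness ([integral_ball_kernel_density_le]): let m(s) be the essential
    supremum of gamma(s, .). Integrating first in y, a ball of radius s has
    volume at most (2 s)^n, which cancels s^-n, so K_1(u) <= 2^n times the
    integral of m, for every u. Bounded support
    ([integral_ball_kernel_support]): K_1(u) vanishes as soon as one coordinate
    of u is at least alpha + beta in absolute value. Hence K_j <= j^n c on a
    ball of radius r = (n+1) (alpha + beta) / j and K_j = 0 off it. As this ball
    has volume at most (2 r)^n, the powers of j cancel, and the average is at
    most c (2 (n+1) (alpha + beta))^n f^*(x). Euclidean balls are only ever
    compared with cubes, whose volume is a product; this costs no more than
    dimensional constants.

    Two measure-theoretic points need care. The functions f and gamma are only
    Lebesgue measurable, and the essential supremum of gamma(s, .) need not be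
    Borel in s. Both are replaced by Borel majorants that agree with them off a
    null set ([completed_measurable_fun_envelope]); the comparison goes through
    because the integral of any nonnegative function is a supremum over simple
    minorants, hence monotone without measurability. The second point is that
    the complement of the support of a measure is null, which holds because
    boxes with rational data form a countable base
    ([negligible_setC_support]). *)

(** * Lower integrals and completed measurability *)

Section integration.
Context d (T : measurableType d) (R : realType).
Variable mu : {measure set T -> \bar R}.
Local Open Scope ereal_scope.
Import HBNNSimple.

(** The integral of a nonnegative function, measurable or not, is the supremum
    of the integrals of its simple minorants, and g has more of them than f. *)
Lemma ge0_le_integral_lower (D : set T) (f g : T -> \bar R) :
  (forall x, D x -> 0 <= f x) -> (forall x, D x -> f x <= g x) ->
  \int[mu]_(x in D) f x <= \int[mu]_(x in D) g x.
Proof.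
move=> f0 fg.
have g0 x : D x -> 0 <= g x by move=> Dx; rewrite (le_trans (f0 _ Dx))// fg.
rewrite !ge0_integralE//; apply: le_ereal_sup => _ [h /= hf <-].
exists h => // x; apply: (le_trans (hf x)); rewrite !patchE.
by case: ifPn => // /set_mem; exact: fg.
Qed.

Lemma ge0_subset_integral_lower (D E : set T) (f : T -> \bar R) : D `<=` E ->
  (forall x, E x -> 0 <= f x) ->
  \int[mu]_(x in D) f x <= \int[mu]_(x in E) f x.
Proof.
move=> DE f0; rewrite integral_mkcond [leRHS]integral_mkcond.
apply: ge0_le_integral_lower => x _; rewrite !patchE.
  by case: ifPn => // /set_mem /DE /f0.
case: ifPn => [/set_mem /DE Ex|_]; first by rewrite mem_set.
by case: ifPn => // /set_mem /f0.
Qed.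

Lemma measure_bigcup_countType_eq0 (I : countType) (F : I -> set T) :
  (forall i, measurable (F i)) -> (forall i, mu (F i) = 0) ->
  mu (\bigcup_i F i) = 0.
Proof.
move=> mF F0.
have mUF : measurable (\bigcup_i F i) by exact: countable_bigcupT_measurable.
apply: measure_negligible => //.
pose G n := if unpickle n is Some i then F i else set0.
apply: (@negligibleS _ _ _ mu (\bigcup_n G n)).
  by move=> x [i _ Fix]; exists (pickle i) => //; rewrite /G pickleK.
apply: negligible_bigcup => n; rewrite /G.
case: unpickle => [i|]; last exact: negligible_set0.
by exists (F i); split.
Qed.

(** Each of the countably many sets where f exceeds a given rational is Borel up
    to a null set; removing all these null sets at once leaves f Borel. *)
Lemma completed_measurable_fun_ae (D : set T) (f : T -> R) : measurable D ->
  completed_measurable_fun mu D f ->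
  exists N, [/\ measurable N, mu N = 0 & measurable_fun (D `\` N) f].
Proof.
move=> mD mf.
pose r (q : rat) : set R := `]ratr q, +oo[%classic.
have H q : exists AN : set T * set T,
    [/\ measurable AN.1, measurable AN.2, mu AN.2 = 0,
        AN.1 `<=` D `&` f @^-1` r q
      & (D `&` f @^-1` r q) `\` AN.2 `<=` AN.1].
  have [A mA [N [M [mM M0 NM]] AN]] := mf (r q) (measurable_itv _).
  exists (A, M); split => //=; first by rewrite -AN; exact: subsetUl.
  by rewrite -AN => x [[//|/NM]].
have {H}[F HF] := choice H.
pose N := \bigcup_(q : rat) (F q).2.
have mN : measurable N.
  by apply: bigcupT_measurable_rat => q; have [] := HF q.
exists N; split => //.
  by apply: measure_bigcup_countType_eq0 => q; have [] := HF q.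
apply: (measurability _ (RGenOInfty.measurableE R)) => //.
move=> /= _ [_ [a ->] <-].
rewrite [X in measurable X](_ : _ =
    (\bigcup_(q in [set q : rat | (a < ratr q)%R]) (F q).1) `\` N).
  apply: measurableD => //; rewrite bigcup_mkcond.
  apply: bigcupT_measurable_rat => q; case: ifP => // _.
  by have [] := HF q.
apply/seteqP; split => x /=.
  rewrite in_itv/= andbT => -[[Dx Nx] afx]; split => //.
  have [q] := rat_in_itvoo afx; rewrite in_itv/= => /andP[aq qfx].
  exists q; first by [].
  have [_ _ _ _] := HF q; apply; split; last by contra: Nx => Nx; exists q.
  by split => //=; rewrite /r/= in_itv/= andbT.
move=> [[q aq Aqx] Nx]; have [_ _ _ /(_ _ Aqx)[Dx + ] _] := HF q.
rewrite /r/= !in_itv/= !andbT => qfx; split => //.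
exact: lt_trans qfx.
Qed.

End integration.

Section envelope.
Context d (T : measurableType d) (R : realType).
Variable mu : {measure set T -> \bar R}.
Local Open Scope ereal_scope.
Import HBNNSimple.

(** The majorant takes the value +oo on the exceptional null set, so that it
    dominates f everywhere and not just almost everywhere. *)
Lemma completed_measurable_fun_envelope (D : set T) (f : T -> R) :
  measurable D -> completed_measurable_fun mu D f ->
  (forall x, D x -> (0 <= f x)%R) ->
  exists g : T -> \bar R, [/\ measurable_fun [set: T] g,
    forall x, 0 <= g x, forall x, D x -> (f x)%:E <= g x &
    exists N, [/\ measurable N, mu N = 0 &
      forall x, (D `\` N) x -> g x = (f x)%:E]].
Proof.
move=> mD mf f0; have [N [mN N0 mfN]] := completed_measurable_fun_ae mD mf.
have mDN : measurable (D `\` N) by exact: measurableD.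
have gNE x : N x -> (((EFin \o f) \_ (D `\` N)) \+ (cst +oo) \_ N) x = +oo.
  move=> Nx; rewrite /= !patchE (mem_set Nx) memNset ?add0e//.
  by move=> [].
have gDE x : (D `\` N) x ->
    (((EFin \o f) \_ (D `\` N)) \+ (cst +oo) \_ N) x = (f x)%:E.
  move=> DNx; rewrite /= !patchE (mem_set DNx) memNset ?adde0//.
  by case: DNx.
exists (((EFin \o f) \_ (D `\` N)) \+ (cst +oo) \_ N); split.
- apply: emeasurable_funD; last first.
    by apply: (measurable_restrictT _ mN).1.
  by apply: (measurable_restrictT _ mDN).1; exact/measurable_EFinP.
- move=> x; apply: adde_ge0; last first.
    by rewrite patchE; case: ifP => _; rewrite ?leey.
  by rewrite patchE; case: ifP => // /set_mem[Dx _]; rewrite lee_fin f0.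
- move=> x Dx; have [Nx|Nx] := pselect (N x); first by rewrite gNE// leey.
  by rewrite gDE.
- by exists N.
Qed.

(** Checked on simple functions, level set by level set. *)
Lemma ge0_integral_le_density (nu : {measure set T -> \bar R})
    (k h : T -> \bar R) :
  measurable_fun [set: T] k -> (forall x, 0 <= k x) ->
  measurable_fun [set: T] h -> (forall x, 0 <= h x) ->
  (forall E, measurable E -> nu E <= \int[mu]_(x in E) k x) ->
  \int[nu]_x h x <= \int[mu]_x (h x * k x).
Proof.
move=> mk k0 mh h0 nuk; rewrite ge0_integralTE//.
apply: ge_ereal_sup => _ [p /= ph <-].
have mp r : measurable (p @^-1` [set r]).
  by rewrite -[X in measurable X]setTI; exact: measurable_funP.
apply: (@le_trans _ _ (\int[mu]_x ((p x)%:E * k x))); last first.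
  apply: ge0_le_integral_lower => x _.
    by rewrite mule_ge0// lee_fin fun_ge0.
  by rewrite lee_wpmul2r.
rewrite sintegralE.
(* at x, only the term of the level r = p x survives *)
have pE x : (p x)%:E * k x =
    \sum_(r \in range p) (r%:E * (k \_ (p @^-1` [set r])) x).
  rewrite (fsbigD1 (p x))//=; last by exists x.
  rewrite patchE mem_set//= fsbig1 ?adde0// => r [_ /= rp].
  by rewrite patchE memNset ?mule0//= => /esym.
under eq_integral do rewrite pE.
rewrite ge0_integral_fsum//=.
- apply: lee_fsum => [|r rp]; first exact: fimfunP.
  have [r0|r0] := leP 0%R r; last first.
    by case: rp => x _ xr; move: r0; rewrite -xr ltNge fun_ge0.
  rewrite ge0_integralZl//.
  + rewrite -integral_mkcond lee_wpmul2l// ?lee_fin//; exact: nuk.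
  + by apply: (measurable_restrictT _ (mp r)).1; exact: measurable_funTS.
  + by move=> x _; apply: erestrict_ge0.
- move=> r; apply: measurable_funeM.
  by apply: (measurable_restrictT _ (mp r)).1; exact: measurable_funTS.
- move=> r x _; rewrite patchE; case: ifPn => [/set_mem /= <-|_].
    by rewrite mule_ge0// lee_fin fun_ge0.
  by rewrite mule0.
Qed.

End envelope.

Lemma completed_measurable_fun_normr d (T : measurableType d) (R : realType)
    (mu : set T -> \bar R) (f : T -> R) :
  completed_measurable_fun mu setT f ->
  completed_measurable_fun mu setT (fun x => `|f x|).
Proof.
move=> mf Y mY; apply: (mf ((@Num.norm _ R) @^-1` Y)).
by rewrite -[X in measurable X]setTI; exact: normr_measurable.
Qed.

(** As f may fail to be measurable, it cannot be replaced by g in an integral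
    directly: the null set is first removed on the side of g, then
    put back on the side of f by monotonicity. *)
Lemma ae_eq_integral_le_lower d (T : measurableType d) (R : realType)
    (mu : {measure set T -> \bar R}) (A N : set T) (f g : T -> \bar R) :
  measurable A -> measurable_fun [set: T] g ->
  (forall x, (0 <= f x)%E) -> (forall x, (0 <= g x)%E) ->
  measurable N -> mu N = 0 -> (forall x, ~ N x -> g x = f x) ->
  (\int[mu]_(x in A) g x <= \int[mu]_(x in A) f x)%E.
Proof.
move=> mA mg f0 g0 mN N0 gf.
rewrite (ge0_negligible_integral mN mA) => [|||//]; last 2 first.
- exact: measurable_funTS.
- by [].
apply: (@le_trans _ _ (\int[mu]_(x in A `\` N) f x)%E).
  by apply: ge0_le_integral_lower => // x [_ Nx]; rewrite gf.
by apply: ge0_subset_integral_lower => //; exact: subDsetl.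
Qed.

(** * Laws dominated by a density depending on one variable *)

Section essential_supremum_sections.
Context d1 d2 (X : measurableType d1) (Y : measurableType d2) (R : realType).
Variable m2 : {sigma_finite_measure set Y -> \bar R}.
Local Open Scope ereal_scope.

(** The essential supremum of g(x, .) exceeds r exactly when the section at x of
    the set where g > r has positive measure, and the measure of sections is a
    measurable function. *)
Lemma measurable_fun_ess_sup_section (g : X * Y -> \bar R) :
  measurable_fun [set: X * Y] g ->
  measurable_fun [set: X] (fun x => ess_sup m2 (fun y => g (x, y))).
Proof.
move=> mg; apply: (measurability _ (ErealGenOInfty.measurableE R)) => //.
move=> /= _ [_ [r ->] <-]; rewrite setTI.
pose A := g @^-1` `]r%:E, +oo[.
have mA : measurable A.
  by rewrite -[A]setTI; apply: mg => //; exact: emeasurable_itv.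
rewrite [X in measurable X](_ : _ =
    (m2 \o xsection A) @^-1` `]0, +oo[).
  rewrite -[X in measurable X]setTI.
  by apply: measurable_fun_xsection => //; exact: emeasurable_itv.
apply/seteqP; split => x /=; rewrite !in_itv/= !andbT;
  (have mgx : measurable_fun setT (fun y => g (x, y))
     by apply: measurableT_comp => //; exact: pair1_measurable);
  (have := ae_le_measureP m2 r%:E mgx); rewrite xsectionE => aeP.
- move=> rx; rewrite lt0e measure_ge0 andbT.
  apply/eqP => /aeP; apply/ess_supP.
  by rewrite -ltNge.
- move=> A0; rewrite ltNge; apply/negP => /ess_supP /aeP A0'.
  by move: A0; rewrite A0' ltxx.
Qed.

End essential_supremum_sections.

Section density_domination.
Context d1 d2 (X : measurableType d1) (Y : measurableType d2) (R : realType).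
Variables (m1 : {sigma_finite_measure set X -> \bar R}).
Variables (m2 : {sigma_finite_measure set Y -> \bar R}).
Local Open Scope ereal_scope.
Let mu : {measure set (X * Y) -> \bar R} := m1 \x m2.

(** Tonelli for the indicator of a null set. *)
Lemma ae_null_section (N : set (X * Y)) : measurable N -> mu N = 0 ->
  \forall x \ae m1, m2 (xsection N x) = 0.
Proof.
move=> mN N0; have mF := measurable_fun_xsection m2 mN.
have [+ _] := ae_eq_integral_abs m1 measurableT mF.
move=> /(_ _)[|Z [mZ Z0 ZN]].
  rewrite -[RHS]N0; apply: eq_integral => x _.
  by rewrite gee0_abs//; exact: measure_ge0.
exists Z; split => // x Nx; apply: ZN => /=; apply: contra_not Nx.
exact.
Qed.

(** The dominating m is the essential supremum of the sections of a Borel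
    majorant g of gamma. Taking it of gamma itself would give a function of x
    that need not be measurable; since almost every section of g agrees with
    that of gamma almost everywhere, m is still below the essential supremum
    norm of gamma(x, .) for almost every x. *)
Lemma density_domination (D : set X) (gamma : X * Y -> R)
    (nu : set (X * Y) -> \bar R) :
  measurable D -> 0 < m2 [set: Y] ->
  completed_measurable_fun mu (D `*` [set: Y]) gamma ->
  (forall p, (D `*` [set: Y]) p -> (0 <= gamma p)%R) ->
  (forall E, measurable E ->
     nu E = \int[mu]_(p in (D `*` [set: Y]) `&` E) (gamma p)%:E) ->
  \int[m1]_(x in D) Lnorm m2 +oo (fun y => (gamma (x, y))%:E) < +oo ->
  exists m : X -> \bar R, [/\ measurable_fun [set: X] m,
    forall x, 0 <= m x, forall x, ~ D x -> m x = 0,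
    \int[m1]_x m x < +oo &
    forall E, measurable E -> nu E <= \int[mu]_(p in E) m p.1].
Proof.
move=> mD m2T mgamma gamma0 nuE gammaoo.
have mDT : measurable (D `*` [set: Y]) by exact: measurableX.
have [g [mg g0 gamma_g [N [mN N0 gN]]]] :=
  completed_measurable_fun_envelope mDT mgamma gamma0.
have mgx x : measurable_fun setT (fun y => g (x, y)).
  by apply: measurableT_comp => //; exact: pair1_measurable.
pose M x := ess_sup m2 (fun y => g (x, y)).
have mM : measurable_fun setT M by exact: measurable_fun_ess_sup_section.
have M0 x : 0 <= M x by apply: ess_sup_gee => //; apply: nearW.
have mMD : measurable_fun setT (M \_ D).
  by apply: (measurable_restrictT _ mD).1; exact: measurable_funTS.
have MD0 x : 0 <= (M \_ D) x by rewrite patchE; case: ifP.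
exists (M \_ D); split => //.
- by move=> x Dx; rewrite patchE memNset.
- rewrite -integral_mkcond; apply: le_lt_trans gammaoo.
  have [Z [mZ Z0 ZN]] := ae_null_section mN N0.
  rewrite (ge0_negligible_integral mZ mD)//; last exact: measurable_funTS.
  apply: le_trans (ge0_subset_integral_lower _ (@subDsetl _ D Z) _); last first.
    by move=> x _; exact: Lnorm_ge0.
  apply: ge0_le_integral_lower => // x [Dx Zx].
  have Nx : m2 (xsection N x) = 0 by apply: contrapT => Nx; exact/Zx/ZN.
  rewrite unlock/= m2T; apply: le_ess_sup.
  exists (xsection N x); split => //; first exact: measurable_xsection.
  move=> y /=; apply: contra_notP => Nxy.
  have Nxy' : ~ N (x, y) by move=> ?; apply: Nxy; rewrite xsectionE.
  by rewrite gN//= lee_fin ler_norm.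
- move=> E mE; rewrite nuE// integral_mkcond.
  have mDE : measurable (D `*` [set: Y] `&` E) by exact: measurableI.
  apply: (@le_trans _ _ (\int[mu]_p (g \_ (D `*` [set: Y] `&` E)) p)).
    apply: ge0_le_integral_lower => p _; rewrite !patchE.
      by case: ifPn => // /set_mem[Dp _]; rewrite lee_fin gamma0.
    by case: ifPn => // /set_mem[Dp _]; rewrite gamma_g.
  have mgE : measurable_fun setT (g \_ (D `*` [set: Y] `&` E)).
    by apply: (measurable_restrictT _ mDE).1; exact: measurable_funTS.
  have gE0 p : 0 <= (g \_ (D `*` [set: Y] `&` E)) p.
    by rewrite patchE; case: ifP.
  have mME : measurable_fun setT ((fun p : X * Y => (M \_ D) p.1) \_ E).
    apply: (measurable_restrictT _ mE).1; apply: measurable_funTS.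
    exact: measurableT_comp.
  have ME0 p : 0 <= ((fun p : X * Y => (M \_ D) p.1) \_ E) p.
    by rewrite patchE; case: ifP.
  rewrite [leRHS]integral_mkcond fubini_tonelli1// [leRHS]fubini_tonelli1//.
  apply: ge0_le_integral_lower => x _; first exact: integral_ge0.
  apply: ae_ge0_le_integral => //.
  + by apply: measurableT_comp => //; exact: pair1_measurable.
  + by apply: measurableT_comp => //; exact: pair1_measurable.
  + have [Z [mZ Z0 ZM]] := ess_sup_ge m2 (fun y => g (x, y)).
    exists Z; split => // y; apply: contra_notP => /= Zy _.
    rewrite !patchE; case: ifPn => [/set_mem[[/= Dx _] Exy]|_].
      by rewrite !mem_set// /M; apply: contrapT => ?; exact/Zy/ZM.
    by case: ifP => // _; case: ifP.
Qed.

(** Tonelli turns the density bound into an iterated integral, in which m, not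
    depending on y, comes out of the inner integral. *)
Lemma integral_le_density_prod (nu : {measure set (X * Y) -> \bar R})
    (m : X -> \bar R) (h : X * Y -> \bar R) :
  measurable_fun [set: X] m -> (forall x, 0 <= m x) ->
  measurable_fun [set: X * Y] h -> (forall p, 0 <= h p) ->
  (forall E, measurable E -> nu E <= \int[mu]_(p in E) m p.1) ->
  \int[nu]_p h p <= \int[m1]_x (m x * \int[m2]_y h (x, y)).
Proof.
move=> mm m0 mh h0 num.
have mk : measurable_fun setT (fun p : X * Y => m p.1).
  exact: measurableT_comp.
apply: (le_trans (ge0_integral_le_density mk _ mh h0 num)) => //.
rewrite fubini_tonelli1//; last 2 first.
- exact: emeasurable_funM.
- by move=> p; rewrite mule_ge0.
rewrite le_eqVlt; apply/orP; left; apply/eqP; apply: eq_integral => x _.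
rewrite /fubini_F/= ge0_integralZr//; first by rewrite muleC.
by apply: measurableT_comp => //; exact: pair1_measurable.
Qed.

End density_domination.

(** * Euclidean balls and cubes *)

Section euclidean_balls.
Context (R : realType).
Local Open Scope ring_scope.

Definition cube n (x : 'rV[R]_n) (r : R) : set 'rV[R]_n :=
  [set z | forall i, `|x ord0 i - z ord0 i| < r].

Lemma rV_cons0 n (p : R * 'rV[R]_n) : rV_cons p ord0 ord0 = p.1.
Proof.
rewrite /rV_cons (_ : (ord0 : 'I_n.+1) = lshift n (ord0 : 'I_1)).
  by rewrite (row_mxEl (p.1%:M : 'rV_1) p.2) mxE eqxx.
exact/val_inj.
Qed.

Lemma rV_cons_lift n (p : R * 'rV[R]_n) i :
  rV_cons p ord0 (lift ord0 i) = p.2 ord0 i.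
Proof.
rewrite /rV_cons (_ : lift ord0 i = rshift 1 i) ; last exact/val_inj.
by rewrite (row_mxEr (p.1%:M : 'rV_1) p.2).
Qed.

Lemma measurable_enorm n : measurable_fun [set: 'rV[R]_n] (@enorm R n).
Proof.
have msqrt : measurable_fun [set: R] (@Num.sqrt R).
  by apply: continuous_measurable_fun; exact: sqrt_continuous.
apply: (measurableT_comp msqrt).
apply: measurable_sum => i; apply: measurable_funX.
exact: measurable_rV_coord.
Qed.

Lemma coord_le_enorm n (v : 'rV[R]_n) i : `|v ord0 i| <= enorm v.
Proof.
rewrite -sqrtr_sqr /enorm ler_wsqrtr// (bigD1 i)//= lerDl.
by apply: sumr_ge0 => j _; exact: sqr_ge0.
Qed.

(** The factor n+1 rather than sqrt n keeps the inequality strict and covers the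
    dimension 0. *)
Lemma enorm_lt n (v : 'rV[R]_n) t : 0 < t ->
  (forall i, `|v ord0 i| < t) -> enorm v < n.+1%:R * t.
Proof.
move=> t0 vt.
have nt0 : 0 < n.+1%:R * t by rewrite mulr_gt0.
rewrite -[ltRHS]ger0_norm ?(ltW nt0)// -sqrtr_sqr /enorm ltr_sqrt ?exprn_gt0//.
apply: (@le_lt_trans _ _ (\sum_(i < n) t ^+ 2)).
  apply: ler_sum => i _.
  by rewrite -real_normK ?num_real// lerXn2r ?nnegrE// ltW.
rewrite sumr_const card_ord -[ltLHS]mulr_natl exprMn.
rewrite ltr_pM2r ?exprn_gt0//.
rewrite (@lt_le_trans _ _ n.+1%:R)// ?ltr_nat//.
by rewrite -natrX ler_nat -mulnn leq_pmulr.
Qed.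

Lemma measurable_fun_sub_rV d (T : measurableType d) n (f g : T -> 'rV[R]_n) :
  measurable_fun [set: T] f -> measurable_fun [set: T] g ->
  measurable_fun [set: T] (fun t => f t - g t).
Proof.
move=> mf mg; apply: measurable_fun_rVP => i.
under eq_fun do rewrite !mxE.
by apply: measurable_funB; apply: (measurableT_comp (measurable_rV_coord i)).
Qed.

Lemma measurable_eball n (x : 'rV[R]_n) r : measurable (eball x r).
Proof.
rewrite (_ : eball x r = (fun z => enorm (x - z)) @^-1` `]-oo, r[%classic).
  rewrite -[X in measurable X]setTI.
  have : measurable_fun setT (fun z : 'rV[R]_n => enorm (x - z)).
    apply: measurableT_comp; first exact: measurable_enorm.
    exact: measurable_fun_sub_rV.
  by apply => //; exact: measurable_itv.
by apply/seteqP; split => z /=; rewrite in_itv.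
Qed.

Lemma measurable_cube n (x : 'rV[R]_n) r : measurable (cube x r).
Proof.
rewrite (_ : cube x r = ~` \bigcup_i
  ((fun z : 'rV[R]_n => z ord0 i) @^-1` ~` ball (x ord0 i) r)); last first.
  apply/seteqP; split => [z xz [i _]|z xz i]; first by apply; exact: xz.
  by apply: contrapT => xzi; apply: xz; exists i.
apply: measurableC; apply: countable_bigcupT_measurable => // i.
rewrite -[X in measurable X]setTI; apply: measurable_rV_coord => //.
by apply: measurableC; exact: measurable_ball.
Qed.

(** Induction on the dimension: the cube is a product of an interval and a cube,
    as the Lebesgue measure is a product. *)
Lemma lebesgue_rV_cube n (x : 'rV[R]_n) r : 0 <= r ->
  lebesgue_rV n (cube x r) = ((2 * r) ^+ n)%:E.
Proof.
move=> r0; elim: n x => [x|n IH x].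
  rewrite expr0 /= (_ : cube x r = setT) ?diracT//.
  by apply/seteqP; split => // z _ [].
rewrite /= /lebesgue_rV_step /pushforward.
rewrite (_ : _ @^-1` _ = ball (x ord0 ord0) r `*`
   cube (\row_i x ord0 (lift ord0 i)) r); last first.
  apply/seteqP; split => [[a z]/= H|[a z]/= [H0 H] i].
    split; first by have := H ord0; rewrite rV_cons0.
    by move=> i; have := H (lift ord0 i); rewrite rV_cons_lift mxE.
  have [j ->|->] := unliftP ord0 i.
    by have := H j; rewrite mxE rV_cons_lift.
  by rewrite rV_cons0.
rewrite product_measure1E//; [|exact: measurable_ball|exact: measurable_cube].
transitivity ((r *+ 2)%:E * ((2 * r) ^+ n)%:E)%E; last first.
  by rewrite -EFinM exprS mulr_natl.
by congr (_ * _)%E; [exact: lebesgue_measure_ball|exact: IH].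
Qed.

Lemma eball_sub_cube n (x : 'rV[R]_n) r : eball x r `<=` cube x r.
Proof.
move=> z xz i; have := coord_le_enorm (x - z) i; rewrite !mxE => /le_lt_trans.
exact.
Qed.

Lemma cube_sub_eball n (x : 'rV[R]_n) r : 0 < r ->
  cube x r `<=` eball x (n.+1%:R * r).
Proof. by move=> r0 z xz; apply: enorm_lt => // i; rewrite !mxE. Qed.

Lemma lebesgue_rV_eball_le n (x : 'rV[R]_n) r : 0 <= r ->
  (lebesgue_rV n (eball x r) <= ((2 * r) ^+ n)%:E)%E.
Proof.
move=> r0; rewrite -(lebesgue_rV_cube x r0); apply: le_measure; rewrite ?inE.
- exact: measurable_eball.
- exact: measurable_cube.
- exact: eball_sub_cube.
Qed.

Lemma lebesgue_rV_eball_gt0 n (x : 'rV[R]_n) r : 0 < r ->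
  (0 < lebesgue_rV n (eball x r))%E.
Proof.
move=> r0; have rn0 : 0 < r / n.+1%:R by rewrite divr_gt0.
apply: (@lt_le_trans _ _ (lebesgue_rV n (cube x (r / n.+1%:R)))).
  by rewrite lebesgue_rV_cube ?ltW// lte_fin exprn_gt0// mulr_gt0.
apply: le_measure; rewrite ?inE.
- exact: measurable_cube.
- exact: measurable_eball.
- by apply: subset_trans (cube_sub_eball rn0) _; rewrite mulrC divfK.
Qed.

End euclidean_balls.

(** * The complement of the support is null *)

Section support.
Context (R : realType) (n : nat).
Local Open Scope ring_scope.

Definition rational_box (i : rat * 'rV[rat]_n * nat) : set (R * 'rV[R]_n) :=
  ball (ratr i.1.1 : R) i.2.+1%:R^-1 `*` cube (map_mx ratr i.1.2) i.2.+1%:R^-1.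

Lemma measurable_rational_box i : measurable (rational_box i).
Proof.
by apply: measurableX; [exact: measurable_ball|exact: measurable_cube].
Qed.

Lemma rat_approx (x e : R) : 0 < e -> exists q : rat, `|ratr q - x| < e.
Proof.
move=> e0; have [q] : exists q : rat, ratr q \in `](x - e), (x + e)[%R.
  by apply: rat_in_itvoo; rewrite ltrBlDr -addrA ltrDl addr_gt0.
by rewrite in_itv/= -ltr_distlC distrC => xq; exists q.
Qed.

(** The topology of the product is that of the sup norm: a rational box of
    radius 1/(k+1) < e/2 around a point within 1/(k+1) of p fits in the ball of
    radius e at p. *)
Lemma open_rational_box (U : set (R * 'rV[R]_n)) p : open U -> U p ->
  exists i, rational_box i p /\ rational_box i `<=` U.
Proof.
move=> oU Up; have /nbhs_ballP[e/= e0 eU] : nbhs p U by exact: open_nbhs_nbhs.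
have [k ke] : exists k : nat, k.+1%:R^-1 < e / 2 :> R.
  exists (Num.truncn (e / 2)^-1).
  rewrite -[ltRHS]invrK ltf_pV2 ?posrE ?invr_gt0//.
  - exact: truncnS_gt.
  - exact: divr_gt0.
have k0 : 0 < k.+1%:R^-1 :> R by rewrite invr_gt0.
have [q qp] := rat_approx p.1 k0.
have [v vp] := choice (fun i : 'I_n => rat_approx (p.2 ord0 i) k0).
exists (q, \row_i v i, k); split; first by split => //= i; rewrite !mxE.
move=> [a b] [/= qa vb]; apply: eU; split => /=.
  rewrite -ball_normE/= (splitr e) -(subrKA (ratr q)).
  rewrite (le_lt_trans (ler_normD _ _))//.
  by rewrite ltrD// ?(lt_trans _ ke)// distrC.
split=> // i j; rewrite ord1 -ball_normE/= (splitr e).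
rewrite -(subrKA (ratr (v j))) (le_lt_trans (ler_normD _ _))//.
rewrite ltrD// ?(lt_trans _ ke)//; first by rewrite distrC.
by have := vb j; rewrite !mxE.
Qed.

Lemma open_measurable_prod_rV (U : set (R * 'rV[R]_n)) : open U -> measurable U.
Proof.
move=> oU.
rewrite (_ : U = \bigcup_(i in [set i | rational_box i `<=` U]) rational_box i).
  rewrite bigcup_mkcond; apply: countable_bigcupT_measurable => // i.
  by case: ifP => // _; exact: measurable_rational_box.
apply/seteqP; split => [p Up|p [i iU ip]]; last exact: iU.
by have [i [ip iU]] := open_rational_box oU Up; exists i.
Qed.

(** A point outside the support has a null open neighbourhood, hence lies in a
    null rational box, and there are countably many such boxes. *)
Lemma negligible_setC_support (nu : {measure set (R * 'rV[R]_n) -> \bar R}) :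
  nu.-negligible (~` support_of nu).
Proof.
pose B i := if nu (rational_box i) == 0 then rational_box i else set0.
exists (\bigcup_i B i); split.
- apply: countable_bigcupT_measurable => // i; rewrite /B.
  by case: ifP => // _; exact: measurable_rational_box.
- apply: measure_bigcup_countType_eq0 => i; rewrite /B.
    by case: ifP => // _; exact: measurable_rational_box.
  by case: ifP => [/eqP//|_]; exact: measure0.
- move=> p /existsNP[U] /not_implyP[oU] /not_implyP[Up] /negP nuU.
  have [i [ip iU]] := open_rational_box oU Up; exists i => //.
  rewrite /B ifT// -measure_le0; apply: le_trans (_ : nu U <= 0)%E.
    apply: le_measure; rewrite ?inE//; first exact: measurable_rational_box.
    exact: open_measurable_prod_rV.
  by rewrite leNgt.
Qed.

End support.

(** * Averages over random balls *)

Section ball_kernel.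
Context (R : realType) (n : nat).
Local Open Scope ring_scope.

Definition ball_kernel (p : R * 'rV[R]_n) (u : 'rV[R]_n) : R :=
  (p.1 ^+ n)^-1 * (enorm (u - p.2) < p.1)%R%:R.

Lemma enorm_ge0 (v : 'rV[R]_n) : 0 <= enorm v.
Proof. exact: sqrtr_ge0. Qed.

Lemma enormZ (a : R) (v : 'rV[R]_n) : 0 <= a -> enorm (a *: v) = a * enorm v.
Proof.
move=> a0; rewrite /enorm; under eq_bigr do rewrite mxE exprMn.
by rewrite -mulr_sumr sqrtrM ?sqr_ge0// sqrtr_sqr ger0_norm.
Qed.

(** For s <= 0 no u satisfies |u - y| < s, which hides the sign of s^-n. *)
Lemma ball_kernel_ge0 p u : 0 <= ball_kernel p u.
Proof.
rewrite /ball_kernel; have [up|] := ltP; last by rewrite mulr0.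
by rewrite mulr1 invr_ge0 exprn_ge0// ltW// (le_lt_trans (enorm_ge0 _) up).
Qed.

Lemma measurable_ball_kernel :
  measurable_fun [set: (R * 'rV[R]_n) * 'rV[R]_n]
    (fun pu => ball_kernel pu.1 pu.2).
Proof.
(* where the indicator does not vanish s is positive, and there s^-1 is the real
   power s `^ (-1), a measurable function of s *)
rewrite (_ : (fun _ => _) = (fun pu : (R * 'rV[R]_n) * 'rV[R]_n =>
    (pu.1.1 `^ (-1)) ^+ n * (enorm (pu.2 - pu.1.2) < pu.1.1)%R%:R)).
  have m11 : measurable_fun setT (fun pu : (R * 'rV[R]_n) * 'rV[R]_n => pu.1.1).
    exact: measurableT_comp.
  apply: measurable_funM.
    apply: measurable_funX.
    exact: (@measurableT_comp _ _ _ _ _ _ (@powR R ^~ (-1))).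
  apply: (@measurableT_comp _ _ _ _ _ _ (fun b : bool => b%:R : R)) => //.
  apply: measurable_fun_ltr => //.
  apply: (measurableT_comp (@measurable_enorm R n)).
  apply: measurable_fun_sub_rV => //.
  exact: measurableT_comp.
apply/funext => -[[s y] u]; rewrite /ball_kernel/=.
have [us|] := ltP; last by rewrite !mulr0.
by rewrite powR_inv1 ?exprVn// ltW// (le_lt_trans (enorm_ge0 _) us).
Qed.

Lemma measurable_ball_kernel_r u :
  measurable_fun [set: R * 'rV[R]_n] (fun p => ball_kernel p u).
Proof.
exact: measurableT_comp measurable_ball_kernel (pair2_measurable u).
Qed.

(** The volume of a ball of radius s is at most (2 s)^n, which cancels s^-n:
    this is what makes the bound on the mean kernel independent of s. *)
Lemma integral_ball_kernel_le (s : R) (u : 'rV[R]_n) : 0 < s ->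
  (\int[lebesgue_rV n]_y (ball_kernel (s, y) u)%:E <= (2 ^+ n)%:E)%E.
Proof.
move=> s0.
have -> : (\int[lebesgue_rV n]_y (ball_kernel (s, y) u)%:E =
    ((s ^+ n)^-1)%:E * lebesgue_rV n (eball u s))%E.
  rewrite -[X in (_ * lebesgue_rV n X)%E]setIT -integral_indic//; last first.
    exact: measurable_eball.
  rewrite -ge0_integralZl//; last 2 first.
  - apply/measurable_EFinP; apply: measurable_indic; exact: measurable_eball.
  - by rewrite lee_fin invr_ge0 exprn_ge0// ltW.
  apply: eq_integral => y _; rewrite -EFinM /ball_kernel/= indicE.
  congr (_ * _)%:E; congr (_%:R); congr (nat_of_bool _).
  by apply/idP/idP => [?|/set_mem//]; rewrite inE.
rewrite lee_pdivrMl ?exprn_gt0// -EFinM -exprMn mulrC.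
by apply: lebesgue_rV_eball_le; exact: ltW.
Qed.

Lemma ball_kernel_scale (c : R) p u : 0 < c ->
  ball_kernel (c^-1 * p.1, c^-1 *: p.2) u = c ^+ n * ball_kernel p (c *: u).
Proof.
move=> c0; rewrite /ball_kernel/= exprMn invfM exprVn invrK -mulrA.
congr (_ * (_ * _)); congr (_%:R); congr (nat_of_bool _).
rewrite -[LHS](ltr_pM2l c0) mulVKf ?gt_eqF// -enormZ ?ltW//.
by rewrite scalerBr scalerA divff ?gt_eqF// scale1r.
Qed.

(** In each coordinate |u_i| <= |u_i - y_i| + |y_i| < s + b <= a + b wherever
    the kernel is positive. *)
Lemma ball_kernel_eq0 (a b : R) p (u : 'rV[R]_n) :
  (`[0, a] `*` eclosed_ball 0 b) p -> ~ cube 0 (a + b) u ->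
  ball_kernel p u = 0.
Proof.
case: p => s y [/= + yb] uab; rewrite in_itv/= => /andP[s0 sa].
rewrite /ball_kernel/=; have [us|] := ltP; last by rewrite mulr0.
exfalso; apply: uab => i.
rewrite mxE sub0r normrN -(subrK (y ord0 i) (u ord0 i)).
rewrite (le_lt_trans (ler_normD _ _))// ltr_leD//.
  have := coord_le_enorm (u - y) i; rewrite !mxE => /le_lt_trans.
  by apply; rewrite (lt_le_trans us).
by have := le_trans (coord_le_enorm (0 - y) i) yb; rewrite !mxE sub0r normrN.
Qed.

End ball_kernel.

Section kernel_bounds.
Context (R : realType) (n : nat).
Local Open Scope ereal_scope.

(** Uniform bound on the mean kernel: the essential supremum m(s) of the density
    comes out of the integral over y, and what remains is at most 2^n. *)
Lemma integral_ball_kernel_density_le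
    (nu : {measure set (R * 'rV[R]_n) -> \bar R}) (m : R -> \bar R) u :
  measurable_fun [set: R] m -> (forall s, 0 <= m s) ->
  (forall s, ~ `]0%R, +oo[%classic s -> m s = 0) ->
  (forall E, measurable E ->
     nu E <= \int[lebesgue_measure \x lebesgue_rV n]_(p in E) m p.1) ->
  \int[nu]_p (ball_kernel p u)%:E
    <= (2 ^+ n)%:E * \int[lebesgue_measure]_s m s.
Proof.
move=> mm m0 mN0 num.
(* The real line of the Lebesgue measure and the real line carry the same Borel
   sets under different names; nu is transported along the identity. *)
pose T : measurableType _ := (measurableTypeR R * 'rV[R]_n)%type.
pose toT (p : R * 'rV[R]_n) : T := p.
have mtoT : measurable_fun setT toT by move=> _ E mE; rewrite setTI.
have [nuT nuTE] : exists nuT : {measure set T -> \bar R},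
  nuT = pushforward nu toT :> (set T -> \bar R) by exact: (ex_intro _ _ erefl).
have mK : measurable_fun [set: T] (fun p : T => (ball_kernel p u)%:E).
  by apply/measurable_EFinP; exact: measurable_ball_kernel_r.
have K0 (p : T) : 0 <= (ball_kernel p u)%:E.
  by rewrite lee_fin ball_kernel_ge0.
have -> : \int[nu]_p (ball_kernel p u)%:E = \int[nuT]_p (ball_kernel p u)%:E.
  by rewrite nuTE (ge0_integral_pushforward mtoT) ?preimage_setT.
have numT E : measurable E ->
    nuT E <= \int[lebesgue_measure \x lebesgue_rV n]_(p in E) m p.1.
  by move=> mE; rewrite nuTE; exact: num.
have nuT_le := @integral_le_density_prod _ _ _ _ R lebesgue_measure
  (lebesgue_rV n) nuT m _ mm m0 mK K0 numT.
apply: (le_trans nuT_le).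
rewrite -ge0_integralZl//.
apply: ge0_le_integral_lower => s _.
  by rewrite mule_ge0//; apply: integral_ge0.
have [s0|s0] := ltP 0%R s; last first.
  rewrite mN0 ?mul0e ?mule0//= in_itv/= andbT => /lt_geF.
  by rewrite s0.
by rewrite muleC lee_wpmul2r//; exact: integral_ball_kernel_le.
Qed.

Lemma integral_ball_kernel_support
    (nu : {measure set (R * 'rV[R]_n) -> \bar R}) (a b : R) u :
  support_of nu `<=` `[0%R, a] `*` eclosed_ball 0 b ->
  ~ cube 0 (a + b) u -> \int[nu]_p (ball_kernel p u)%:E = 0.
Proof.
move=> nuab uab; rewrite -[RHS](integral0 nu setT).
apply: ge0_ae_eq_integral => //.
- by apply/measurable_EFinP; exact: measurable_ball_kernel_r.
- by move=> p _; rewrite lee_fin ball_kernel_ge0.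
have [N [mN N0 suppN]] := negligible_setC_support nu.
exists N; split => // p /= pK; apply: suppN => psupp; apply: pK => _.
by rewrite (ball_kernel_eq0 (nuab _ psupp) uab).
Qed.

End kernel_bounds.

(** * Comparison with the maximal function *)

Section averages.
Context (R : realType) (n : nat).
Local Open Scope ereal_scope.

(** The average over the ball is bounded by the maximal function; multiplying
    back by the volume is legitimate because it is positive and finite. *)
Lemma integral_eball_le_HL (f : 'rV[R]_n -> R) (x : 'rV[R]_n) (r : R) :
  (0 < r)%R ->
  \int[lebesgue_rV n]_(z in eball x r) `|f z|%:E
    <= ((2 * r) ^+ n)%:E * HL_maximal_rV f x.
Proof.
move=> r0; have B0 := lebesgue_rV_eball_gt0 x r0.
have Bfin : lebesgue_rV n (eball x r) \is a fin_num.
  rewrite ge0_fin_numE; last exact: ltW.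
  by apply: (le_lt_trans (lebesgue_rV_eball_le x (ltW r0))); rewrite ltry.
have HL : (lebesgue_rV n (eball x r))^-1 *
    \int[lebesgue_rV n]_(z in eball x r) `|f z|%:E <= HL_maximal_rV f x.
  by apply: ereal_sup_ubound; exists r => //=; rewrite in_itv/= r0.
have I0 : 0 <= (lebesgue_rV n (eball x r))^-1 *
    \int[lebesgue_rV n]_(z in eball x r) `|f z|%:E.
  rewrite mule_ge0 ?inve_ge0 ?(ltW B0)//; apply: integral_ge0 => z _.
  by rewrite lee_fin.
apply: (@le_trans _ _ (lebesgue_rV n (eball x r) *
    ((lebesgue_rV n (eball x r))^-1 *
      \int[lebesgue_rV n]_(z in eball x r) `|f z|%:E))).
  by rewrite muleA divee ?gt_eqF// mul1e.
by apply: lee_pmul => //; exact: lebesgue_rV_eball_le (ltW r0).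
Qed.

Lemma measurable_ball_kernel_mul (g : 'rV[R]_n -> \bar R) (x : 'rV[R]_n) :
  measurable_fun [set: 'rV[R]_n] g ->
  measurable_fun [set: (R * 'rV[R]_n) * 'rV[R]_n]
    (fun pz => (ball_kernel pz.1 (x - pz.2))%:E * g pz.2).
Proof.
move=> mg.
have mq : measurable_fun setT
    (fun pz : (R * 'rV[R]_n) * 'rV[R]_n => (pz.1, x - pz.2)%R).
  by apply: measurable_fun_pair => //; exact: measurable_fun_sub_rV.
apply: emeasurable_funM; last exact: measurableT_comp.
apply/measurable_EFinP.
exact: (measurableT_comp (@measurable_ball_kernel R n) mq).
Qed.

(** Tonelli exchanges the two integrals, so that only the mean kernel under nu
    matters: bounded by c, and zero off a ball. *)
Lemma ball_kernel_average_le (nu : probability (R * 'rV[R]_n)%type R)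
    (g : 'rV[R]_n -> \bar R) (x : 'rV[R]_n) (r c : R) :
  (0 <= c)%R -> measurable_fun [set: 'rV[R]_n] g -> (forall z, 0 <= g z) ->
  (forall u, \int[nu]_p (ball_kernel p u)%:E <= c%:E) ->
  (forall u, ~ (enorm u < r)%R -> \int[nu]_p (ball_kernel p u)%:E = 0) ->
  \int[nu]_p \int[lebesgue_rV n]_z ((ball_kernel p (x - z))%:E * g z)
    <= c%:E * \int[lebesgue_rV n]_(z in eball x r) g z.
Proof.
move=> c0 mg g0 nu_le nu0.
have mK := measurable_ball_kernel_mul x mg.
rewrite (fubini_tonelli (fun pz : (R * 'rV[R]_n) * 'rV[R]_n =>
    (ball_kernel pz.1 (x - pz.2))%:E * g pz.2))//=; last first.
  by move=> pz; rewrite mule_ge0// lee_fin ball_kernel_ge0.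
rewrite -ge0_integralZl//; last 2 first.
- exact: measurable_eball.
- exact: measurable_funTS.
rewrite [leRHS]integral_mkcond.
apply: ge0_le_integral_lower => z _.
  by apply: integral_ge0 => p _; rewrite mule_ge0// lee_fin ball_kernel_ge0.
rewrite ge0_integralZr//; last 2 first.
- by apply/measurable_EFinP; exact: measurable_ball_kernel_r.
- by move=> p _; rewrite lee_fin ball_kernel_ge0.
rewrite patchE; case: ifPn => [_|zB]; first by rewrite lee_wpmul2r.
by rewrite nu0 ?mul0e// => xz; move/negP: zB; apply; rewrite inE.
Qed.

End averages.

Section joint_law.
Context d (Omega : measurableType d) (R : realType) (n : nat).
Variable P : probability Omega R.
Local Open Scope ereal_scope.

Definition joint_rv (e : {mfun Omega >-> R}) (v : {mfun Omega >-> 'rV[R]_n}) :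
    Omega -> R * 'rV[R]_n :=
  fun w => (e w, v w).

HB.instance Definition _ e v := isMeasurableFun.Build _ _ _ _ (joint_rv e v)
  (measurable_fun_pair (measurable_funPT e) (measurable_funPT v)).

(** The scaling hypothesis says that the law of (ej, vj) is the image of the law
    of (e1, v1) under division by j, and the kernel is homogeneous. *)
Lemma integral_ball_kernel_scale (e1 ej : {mfun Omega >-> R})
    (v1 vj : {mfun Omega >-> 'rV[R]_n}) (j : nat) (u : 'rV[R]_n) :
  (1 <= j)%N ->
  (forall E, measurable E ->
     joint_law P ej vj E = joint_law P e1 v1 (scale_set j E)) ->
  \int[distribution P (joint_rv ej vj)]_p (ball_kernel p u)%:E =
  (j%:R ^+ n)%:E *
    \int[distribution P (joint_rv e1 v1)]_p (ball_kernel p (j%:R *: u))%:E.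
Proof.
move=> j1 jE; have j0 : (0 < j%:R :> R)%R by rewrite ltr0n.
pose s (p : R * 'rV[R]_n) := (j%:R^-1 * p.1, j%:R^-1 *: p.2)%R.
have ms : measurable_fun setT s.
  apply: measurable_fun_pair; first exact: measurable_funM.
  apply: measurable_fun_rVP => i; under eq_fun do rewrite mxE.
  apply: measurable_funM => //.
  by apply: (measurableT_comp (measurable_rV_coord i)).
have scaleE E : scale_set j E = s @^-1` E.
  apply/seteqP; split => [_ [[a v] Eav <-]|[a v] /= Eav].
    rewrite /s/= mulKf ?gt_eqF// scalerA mulVf ?gt_eqF// scale1r //.
  exists (s (a, v)) => //=.
  by rewrite mulVKf ?gt_eqF// scalerA divff ?gt_eqF// scale1r.
transitivity (\int[pushforward (distribution P (joint_rv e1 v1)) s]_p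
    (ball_kernel p u)%:E).
  apply: eq_measure_integral => E mE _.
  by rewrite [LHS](jE E mE) scaleE.
rewrite ge0_integral_pushforward//; last 2 first.
- by apply/measurable_EFinP; exact: measurable_ball_kernel_r.
- by move=> p _; rewrite lee_fin ball_kernel_ge0.
rewrite preimage_setT -ge0_integralZl//; last 2 first.
- by apply/measurable_EFinP; exact: measurable_ball_kernel_r.
- by move=> p _; rewrite lee_fin ball_kernel_ge0.
by apply: eq_integral => p _; rewrite /= ball_kernel_scale.
Qed.

(** The indicator of (0, 1) is below that of rho < 1, the difference being at
    the centre of the ball. As f is not Borel, the inner integral might not be a
    measurable function of w; replacing |f| by a Borel majorant g makes both
    integrals available to Tonelli and to the change of variables. *)
Lemma maximal_op_term_le (e : {mfun Omega >-> R})
    (v : {mfun Omega >-> 'rV[R]_n}) (f : 'rV[R]_n -> R)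
    (g : 'rV[R]_n -> \bar R) (x : 'rV[R]_n) :
  (forall w, (0 < e w)%R) -> measurable_fun [set: 'rV[R]_n] g ->
  (forall z, `|f z|%:E <= g z) ->
  \int[P]_w \int[lebesgue_rV n]_z ((e w ^+ n)^-1 *
      (\1_(`]0, 1[%classic))%R (enorm (x - v w - z) / e w) * `|f z|)%:E
  <= \int[distribution P (joint_rv e v)]_p \int[lebesgue_rV n]_z
      ((ball_kernel p (x - z))%:E * g z).
Proof.
move=> e0 mg fg.
have g0 z : 0 <= g z by rewrite (le_trans _ (fg z))// lee_fin.
have K0 (p : R * 'rV[R]_n) z : 0 <= (ball_kernel p (x - z))%:E * g z.
  by rewrite mule_ge0// lee_fin ball_kernel_ge0.
rewrite ge0_integral_distribution//; last 2 first.
- exact: (measurable_fun_fubini_tonelli_F (fun pz : (R * 'rV[R]_n) * 'rV[R]_n =>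
    (ball_kernel pz.1 (x - pz.2))%:E * g pz.2)
    (measurable_ball_kernel_mul x mg) (fun pz => K0 pz.1 pz.2)).
- by move=> p; exact: integral_ge0.
have en0 w : (0 <= (e w ^+ n)^-1)%R by rewrite invr_ge0 exprn_ge0// ltW.
apply: ge0_le_integral_lower => w _.
  by apply: integral_ge0 => z _; rewrite lee_fin !mulr_ge0.
apply: ge0_le_integral_lower => z _; first by rewrite lee_fin !mulr_ge0.
rewrite EFinM; apply: lee_pmul => //; first by rewrite lee_fin mulr_ge0.
rewrite lee_fin /ball_kernel/= ler_wpM2l// indicE ler_nat.
have [|] := boolP (_ \in _) => //; rewrite inE/= in_itv/= => /andP[_].
by rewrite ltr_pdivrMr// mul1r addrAC => ->.
Qed.

End joint_law.

Theorem theorem3p5 (R : realType) (n : nat)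
    (d : measure_display) (Omega : measurableType d) (P : probability Omega R)
    (eps : nat -> {RV P >-> R}) (y : nat -> {RV P >-> 'rV[R]_n})
    (gamma : R * 'rV[R]_n -> R) (alpha beta : R) :
  (1 <= n)%N ->
  (forall j w, (1 <= j)%N -> 0 < eps j w) ->
  (forall j (E : set (R * 'rV[R]_n)), (1 <= j)%N -> measurable E ->
     joint_law P (eps j) (y j) E
       = joint_law P (eps 1%N) (y 1%N) (scale_set j E)) ->
  0 < alpha -> 0 < beta ->
  support_of (joint_law P (eps 1%N) (y 1%N))
    `<=` `[0, alpha] `*` eclosed_ball 0 beta ->
  has_density (joint_law P (eps 1%N) (y 1%N)) gamma ->
  L1Linfty gamma ->
  exists C : R, 0 < C /\
    forall f : 'rV[R]_n -> R,
      completed_measurable_fun (lebesgue_rV n) setT f ->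
      forall x : 'rV[R]_n,
        (maximal_op P eps y (\1_(`]0, 1[%classic))%R f x
           <= C%:E * HL_maximal_rV f x)%E.
Proof.
move=> _ eps_gt0 lawE alpha_gt0 beta_gt0 supp_law.
move=> [mgamma gamma_ge0 gammaE] gamma_L1.
pose law j : {measure set (R * 'rV[R]_n) -> \bar R} :=
  distribution P (joint_rv (eps j) (y j)).
have Rn_gt0 : (0 < lebesgue_rV n [set: 'rV[R]_n])%E.
  apply: (lt_le_trans (lebesgue_rV_eball_gt0 0 (@ltr01 R))).
  by apply: le_measure; rewrite ?inE//; exact: measurable_eball.
have [m [mm m0 mN0 m_int law_m]] := @density_domination _ _ _ _ R
  lebesgue_measure (lebesgue_rV n) `]0, +oo[%classic gamma _
  (measurable_itv _) Rn_gt0 mgamma gamma_ge0 gammaE gamma_L1.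
have Im0 : (0 <= \int[lebesgue_measure]_s m s)%E by exact: integral_ge0.
pose c := 2 ^+ n * fine (\int[lebesgue_measure]_s m s)%E.
have c0 : 0 <= c by rewrite mulr_ge0 ?exprn_ge0// fine_ge0.
have K_le u : (\int[law 1%N]_p (ball_kernel p u)%:E <= c%:E)%E.
  rewrite EFinM fineK ?ge0_fin_numE//.
  exact: integral_ball_kernel_density_le.
pose rho := n.+1%:R * (alpha + beta).
have rho_gt0 : 0 < rho by rewrite mulr_gt0// addr_gt0.
exists (1 + c * (2 * rho) ^+ n); split.
  by rewrite ltr_pwDl// mulr_ge0// exprn_ge0// mulr_ge0// ltW.
move=> f mf x.
have [g [mg g0 fg [N [mN N0 gN]]]] := completed_measurable_fun_envelope
  measurableT (completed_measurable_fun_normr mf) (fun z _ => normr_ge0 (f z)).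
have HL0 : (0 <= HL_maximal_rV f x)%E.
  apply: (@le_trans _ _ ((lebesgue_rV n (eball x 1))^-1 *
      \int[lebesgue_rV n]_(z in eball x 1) `|f z|%:E)%E).
    rewrite mule_ge0 ?inve_ge0//; apply: integral_ge0 => z _.
    by rewrite lee_fin.
  by apply: ereal_sup_ubound; exists 1 => //=; rewrite in_itv/= ltr01.
apply: ge_ereal_sup => _ [j /= j1 <-].
have j0 : 0 < j%:R :> R by rewrite ltr0n.
(* the ball of radius r contains the cube of half-side (alpha + beta) / j, off
   which the j-th mean kernel vanishes *)
pose r := n.+1%:R * ((alpha + beta) / j%:R).
have r0 : 0 < r by rewrite mulr_gt0// divr_gt0// addr_gt0.
have fg' z : (`|f z|%:E <= g z)%E by exact: fg.
apply: (le_trans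
  (maximal_op_term_le P (y j) x (fun w => eps_gt0 j w j1) mg fg')).
have cj0 : 0 <= j%:R ^+ n * c by rewrite mulr_ge0// exprn_ge0// ltW.
have law_scale u := integral_ball_kernel_scale u j1 (fun E => lawE j E j1).
apply: (@le_trans _ _ ((j%:R ^+ n * c)%:E *
    \int[lebesgue_rV n]_(z in eball x r) g z)%E).
  apply: ball_kernel_average_le => // u.
    rewrite law_scale EFinM lee_wpmul2l// lee_fin exprn_ge0// ltW//.
  have law1_supp v :=
    @integral_ball_kernel_support _ _ (law 1%N) _ _ v supp_law.
  move=> ur; rewrite law_scale law1_supp ?mule0//.
  move=> ju; apply: ur; apply: enorm_lt; first by rewrite divr_gt0// addr_gt0.
  move=> i; have := ju i; rewrite !mxE sub0r normrN normrM gtr0_norm//.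
  by rewrite ltr_pdivlMr// mulrC.
(* back from g to f: the two agree off the null set N *)
apply: (@le_trans _ _ ((j%:R ^+ n * c)%:E *
    (((2 * r) ^+ n)%:E * HL_maximal_rV f x))%E).
  rewrite lee_wpmul2l//; apply: le_trans (integral_eball_le_HL f x r0).
  apply: ae_eq_integral_le_lower mN N0 _ => //; first exact: measurable_eball.
  by move=> z Nz; apply: gN.
rewrite muleA -EFinM lee_wpmul2r// lee_fin.
(* j r = rho: the powers of j cancel *)
rewrite (_ : j%:R ^+ n * c * (2 * r) ^+ n = c * (2 * rho) ^+ n) ?lerDr//.
rewrite (mulrC _ c) -mulrA -exprMn; congr (_ * _ ^+ _).
by rewrite /r /rho; field; rewrite gt_eqF.
Qed.
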